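(* Let $N\ge 3$ and let $T^1_N$ be the cycle with vertex set $X=\{x_0,\dots,x_{N-1}\}$ (indices mod $N$) and edges $\{x_j,x_{j+1}\}$. Let $M\subset X$ be a nonempty set of marked vertices, $m=|M|$, and let $W'$ be the search time evolution matrix on $T^1_N$ with marked set $M$ (defined in the context). Let $F'\subset X\setminus M$ be the set of non-marked vertices both of whose neighbours are marked, and let $F_1,\dots,F_r$ be the remaining connected components of the subgraph of $T^1_N$ induced on $X\setminus M$ (each a path with at least two vertices), $F=F_1\sqcup\dots\sqcup F_r$, so $X\setminus M=F\sqcup F'$. Put $c_M=|M|/N$, $c_F=|F|/N$, $c_{F'}=|F'|/N$, $c_j=|F_j|/N$. Then for real $u\in(0,1)$, $$\zeta(W',T^1_N,u)^{-1}=\exp\Big[3c_M\log(1-u)+2c_{F'}\log(1+u)+\frac1N\sum_{j=1}^r\sum_{k=1}^{c_jN}\log\Big\{1-2\cos\Big(\frac{2k\pi}{c_jN+1}\Big)u+u^2\Big\}\Big].$$ Moreover, if $N\to\infty$ along a sequence of configurations for which $r$ and the ratios $c_M,c_{F'},c_1,\dots,c_r$ (hence $c_F=c_1+\dots+c_r$) do not depend on $N$, then $$\lim_{N\to\infty}\zeta(W',T^1_N,u)^{-1}=\exp\Big[3c_M\log(1-u)+2c_{F'}\log(1+u)+c_F\int_0^{2\pi}\log(1-2\cos\theta\, u+u^2)\frac{d\theta}{2\pi}\Big].$$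
   Context: Search time evolution matrix. Let $G=(X,E)$ be a connected simple graph with $|X|$ vertices and $\epsilon$ edges, $d_G(x)$ the degree of $x$ in $G$, and $M_X\subset X$ a set of marked vertices with $|M_X|=m$. Let $Y=\{x'\mid x\in X\}$ be a disjoint copy of $X$, $M_Y=\{x'\mid x\in M_X\}$. Let $E'=\{\{x,y'\},\{x',y\}\mid \{x,y\}\in E\}$, $E_2=\{\{x,x'\}\mid x\in M_X\}$, and $E_M=E'\cup E_2$, so $|E_M|=2\epsilon+m$. Define the $(2\epsilon+m)\times|X|$ matrix $K$ (rows indexed by $e\in E_M$, columns by $x\in X$) by $K_{e,x}=1/\sqrt{d_G(x)}$ if $x\in e$ and $x\notin M_X$; $K_{e,x}=1$ if $x\in e$ and $e\in E_2$; $K_{e,x}=0$ otherwise. Define $L$ (columns indexed by $x'\in Y$) analogously: $L_{e,x'}=1/\sqrt{d_G(x)}$ if $x'\in e$ and $x'\notin M_Y$; $L_{e,x'}=1$ if $x'\in e$ and $e\in E_2$; $0$ otherwise. The search time evolution matrix is $W'=(2LL^\top-I_{2\epsilon+m})(2KK^\top-I_{2\epsilon+m})$. Zeta function: for the $d$-dimensional torus $T^d_n$ (vertex set $(\mathbb Z/n\mathbb Z)^d$, which has $dn^d$ edges) and such a matrix $U$ of size $2dn^d+m$, $\zeta(U,T^d_n,u)=\det(I_{2dn^d+m}-uU)^{-1/n^d}$. Here $d=1$, $n=N$, $M_X=M$. *)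

(* Defs.v *)
From HB Require Import structures.
From mathcomp Require Import all_boot all_order all_algebra.
From mathcomp Require Import all_classical all_reals all_analysis.
Set Implicit Arguments. Unset Strict Implicit. Unset Printing Implicit Defensive.
Import Order.TTheory GRing.Theory Num.Theory numFieldNormedType.Exports.
Local Open Scope ring_scope.

Section SearchMatrix.
Variables (R : realType) (T : finType) (adj : rel T) (M : {set T}).
(* G = (T, adj), adj a symmetric irreflexive relation; M = M_X the marked set. *)

(* vertex set X ⊔ Y of the doubled graph: inl x = x, inr x = x' *)
Definition E2 : {set {set (T + T)}} := [set [set inl x; inr x] | x in M].
(* E' = {{x,y'},{x',y} | {x,y} in E}: both orientations of each edge *)
Definition Eprime : {set {set (T + T)}} :=
  [set [set inl p.1; inr p.2] | p in [set p : T * T | adj p.1 p.2]].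
Definition EM : {set {set (T + T)}} := Eprime :|: E2.

Definition deg (x : T) : nat := #|[set y | adj x y]|.

Definition Kentry (e : {set (T + T)}) (x : T) : R :=
  if (inl x \in e) && (x \notin M) then (Num.sqrt (deg x)%:R)^-1
  else if (inl x \in e) && (e \in E2) then 1 else 0.
Definition Lentry (e : {set (T + T)}) (x : T) : R :=
  if (inr x \in e) && (x \notin M) then (Num.sqrt (deg x)%:R)^-1
  else if (inr x \in e) && (e \in E2) then 1 else 0.

Definition Kmx : 'M[R]_(#|EM|, #|T|) :=
  \matrix_(i, j) Kentry (enum_val i) (enum_val j).
Definition Lmx : 'M[R]_(#|EM|, #|T|) :=
  \matrix_(i, j) Lentry (enum_val i) (enum_val j).

Definition Wsearch : 'M[R]_(#|EM|) :=
  (2%:R *: (Lmx *m Lmx^T) - 1%:M) *m (2%:R *: (Kmx *m Kmx^T) - 1%:M).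

Definition zeta (u : R) : R :=
  powR (\det (1%:M - u *: Wsearch)) (- (#|T|%:R)^-1).

Definition Fprime : {set T} :=
  [set x | (x \notin M) && [forall y, adj x y ==> (y \in M)]].

Definition induced_rel : rel T :=
  [rel x y | [&& adj x y, x \notin M & y \notin M]].
Definition comps : {set {set T}} :=
  [set [set y | connect induced_rel x y] | x in ~: M].
Definition Fcomps : {set {set T}} :=
  [set C in comps | [forall x in Fprime, C != [set x]]].

End SearchMatrix.

Definition cycle_adj (N : nat) : rel 'I_N :=
  [rel x y | (val y == (val x).+1 %% N)%N || (val x == (val y).+1 %% N)%N].

Arguments zeta {R T} adj M u.
Arguments Wsearch {R T} adj M.
Arguments Kmx {R T} adj M.
Arguments Lmx {R T} adj M.
Arguments cycle_adj N : clear implicits.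

(* Main.v *)
Require Import Defs.
From HB Require Import structures.
From mathcomp Require Import all_boot all_order all_algebra.
From mathcomp Require Import fingroup perm complex.
From mathcomp Require Import all_classical all_reals all_analysis.
From mathcomp Require Import ring lra.
Set Implicit Arguments. Unset Strict Implicit. Unset Printing Implicit Defensive.
Import Order.TTheory GRing.Theory Num.Theory numFieldNormedType.Exports.

(** With [J = K^T L], Sylvester's determinant identity gives
    [det (1 - u W') (1 - u)^(2N) = (1 - u)^(2N + m) det ((1 + u)^2 - 4 u J J^T)].
    Here [J] is the identity on the marked vertices and half the adjacency matrix
    on the unmarked ones, so with [b^2 = u] the last determinant is the product of
    those of [1 + u - 2 b J] and [1 + u + 2 b J].  Both have an LDL^T
    factorisation along the cycle, starting afresh after every marked vertex, with
    pivots [p_k / p_(k-1)] where [p_l = 1 + u + ... + u^l].  Hence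
    [det (1 - u W') = (1 - u)^(3m) prod_C p_|C|^2] over the unmarked components [C],
    and factoring [X^(l+1) - 1] over the complex numbers turns [p_l^2] into the
    product of the [1 - 2 u cos (2 k pi / (l+1)) + u^2].
    Since [0 <= ln p_l <= - ln (1 - u)], the sum over the components is bounded
    and contributes [0] in the limit; the same product formula makes the Riemann
    sums of the integral tend to [0], so the integral vanishes as well. *)

Local Open Scope ring_scope.


(** * Determinants involving two reflections *)

Lemma det_1B_mulmxC (R : comNzRingType) (m n : nat)
    (A : 'M[R]_(m, n)) (B : 'M[R]_(n, m)) :
  \det (1%:M - A *m B) = \det (1%:M - B *m A).
Proof.
(* One block matrix is factored through each of its two Schur complements. *)
have E1 : block_mx 1%:M A B 1%:M
        = block_mx 1%:M 0 B 1%:M *m block_mx 1%:M A 0 (1%:M - B *m A).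
  by rewrite mulmx_block !mul1mx !mulmx1 ?mul0mx ?mulmx0 !addr0 addrC subrK.
have E2 : block_mx 1%:M A B 1%:M
        = block_mx 1%:M A 0 1%:M *m block_mx (1%:M - A *m B) 0 B 1%:M.
  by rewrite mulmx_block !mul1mx !mulmx1 ?mul0mx ?mulmx0 ?addr0 ?add0r subrK.
have := congr1 determinant E2; rewrite E1 !det_mulmx !(det_lblock, det_ublock).
by rewrite !det1 !(mul1r, mulr1).
Qed.

(** [G = 2 L L^T - 1] is an involution, so [1 + u G] can be inverted explicitly and factored out.
    What is left is an update through [K], which Sylvester's identity brings down to size [p]. The
    power [2 * p] stands on the left to avoid the exponent [n - 2 * p]. *)
Lemma det_1B_two_reflections (F : fieldType) (n p : nat)
    (K L : 'M[F]_(n, p)) (u : F) :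
    K^T *m K = 1%:M -> L^T *m L = 1%:M -> 1 - u != 0 -> 1 + u != 0 ->
  \det (1%:M - u *: ((2%:R *: (L *m L^T) - 1%:M) *m (2%:R *: (K *m K^T) - 1%:M)))
    * (1 - u) ^+ (2 * p)
  = (1 - u) ^+ n
    * \det (((1 + u) ^+ 2)%:M - (4 * u) *: ((K^T *m L) *m (K^T *m L)^T)).
Proof.
move=> KK LL u1 u1'.
set G := 2%:R *: (L *m L^T) - 1%:M.
have GG : G *m G = 1%:M.
  rewrite /G mulmxBl mulmxBr mulmx1 mul1mx -scalemxAl -scalemxAr.
  rewrite -[L *m L^T *m (L *m L^T)]mulmxA [L^T *m (L *m L^T)]mulmxA LL mul1mx.
  by move: (L *m L^T) => P; apply/matrixP => i j; rewrite !mxE; ring.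
have v1 : 1 - u ^+ 2 != 0.
  by rewrite (_ : 1 - u ^+ 2 = (1 - u) * (1 + u)) ?mulf_neq0 //; ring.
(* As [G] squares to 1, [(G - u) / (1 - u^2)] is the inverse of [1 + u G] times [G]. *)
have E0 : (1%:M + u *: G) *m ((1 - u ^+ 2)^-1 *: (G - u%:M)) = G.
  rewrite -scalemxAr mulmxDl mul1mx -scalemxAl mulmxBr GG mul_mx_scalar.
  move: G {GG} => G; apply/matrixP => i j; rewrite !mxE.
  by case: (i == j); rewrite ?(mulr1n, mulr0n); field.
have E1 : 1%:M - u *: (G *m (2%:R *: (K *m K^T) - 1%:M))
   = (1%:M + u *: G) *m
     (1%:M - ((2 * u) *: (((1 - u ^+ 2)^-1 *: (G - u%:M)) *m K)) *m K^T).
  rewrite -scalemxAl [RHS]mulmxBr mulmx1 -scalemxAr -mulmxA.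
  rewrite [(_ + _) *m (_ *m _)]mulmxA E0 mulmxBr mulmx1 -scalemxAr scalerBr.
  by rewrite scalerA (mulrC u) opprB addrA addrAC.
rewrite E1 det_mulmx det_1B_mulmxC.
have E2 : \det (1%:M + u *: G) = (1 - u) ^+ n * ((1 + u) / (1 - u)) ^+ p.
  have -> : 1%:M + u *: G
     = (1 - u) *: (1%:M - ((- (2 * u) / (1 - u)) *: L) *m L^T).
    rewrite /G !scalerBr -scalemxAl !scalerA (mulrC (1 - u)) divfK //.
    move: (L *m L^T) => P; apply/matrixP => i j; rewrite !mxE.
    by case: (i == j); rewrite ?(mulr1n, mulr0n); ring.
  rewrite detZ det_1B_mulmxC -scalemxAr LL scalemx1 -raddfB det_scalar.
  by congr (_ * _ ^+ _); field.
(* With [J = K^T L], one has [K^T (G - u) K = 2 J J^T - (1 + u)], and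
   [1 - u^2 + 2 u (1 + u) = (1 + u)^2]. *)
have E3 : \det (1%:M - K^T *m ((2 * u) *: (((1 - u ^+ 2)^-1 *: (G - u%:M)) *m K)))
   = ((1 - u ^+ 2)^-1) ^+ p
     * \det (((1 + u) ^+ 2)%:M - (4 * u) *: ((K^T *m L) *m (K^T *m L)^T)).
  rewrite -detZ; congr (\det _).
  have -> : (1 - u ^+ 2)^-1 *: (G - u%:M)
      = (2 / (1 - u ^+ 2)) *: (L *m L^T) - ((1 + u) / (1 - u ^+ 2))%:M.
    rewrite /G -addrA -opprD -raddfD scalerBr scalerA scale_scalar_mx.
    by rewrite (mulrC _ 2) (mulrC _ (1 + u)).
  rewrite mulmxBl mul_scalar_mx -scalemxAl scalerBr !scalerA mulmxBr.
  rewrite -!scalemxAr KK trmx_mul trmxK !mulmxA scalerBr scalerA.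
  move: (K^T *m L *m L^T *m K) => P; apply/matrixP => i j; rewrite !mxE.
  by case: (i == j); rewrite ?(mulr1n, mulr0n); field; rewrite v1.
have E4 : ((1 + u) / (1 - u)) ^+ p * ((1 - u ^+ 2)^-1) ^+ p * (1 - u) ^+ (2 * p)
    = 1.
  rewrite exprM -!exprMn -[RHS](expr1n _ p); congr (_ ^+ _).
  by field; rewrite v1.
rewrite E2 E3 -[RHS]mulr1 -[X in _ = _ * X]E4.
set a := (1 - u) ^+ n; set b := (_ / _) ^+ p; set c := _^-1 ^+ p.
set d := (1 - u) ^+ (2 * p); set e := \det _.
by move: a b c d e => a b c d e; ring.
Qed.

(** * Edges of the doubled graph and the matrix [K^T L] *)

Section Graph.
Variables (R : realType) (T : finType) (adj : rel T) (M : {set T}).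
Hypothesis adj_sym : symmetric adj.
Hypothesis adj_irr : irreflexive adj.
Hypothesis deg_gt0 : forall x, (0 < deg adj x)%N.

(** Each edge of the doubled graph has one end in either copy, so an ordered pair encodes it; the
    edges of [E2] become the diagonal pairs of [arcs]. *)
Let arc (p : T * T) : {set (T + T)} := [set inl p.1; inr p.2].
Let arcs : {set T * T} := [set p | adj p.1 p.2 || (p.1 == p.2) && (p.1 \in M)].

Let in_arcl p x : (inl x \in arc p) = (x == p.1).
Proof. by rewrite !inE orbF. Qed.

Let in_arcr p x : (inr x \in arc p) = (x == p.2).
Proof. by rewrite !inE. Qed.

Let arc_inj : injective arc.
Proof.
move=> [a b] [c d] E; have := in_arcl (a, b) a; have := in_arcr (a, b) b.
by rewrite E in_arcl in_arcr /= !eqxx => /eqP -> /eqP ->.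
Qed.

Let EM_arcs : Defs.EM adj M = arc @: arcs.
Proof.
apply/setP => e; apply/setUP/imsetP => [[]|[[a b]]].
- by case/imsetP => p; rewrite inE => ap ->; exists p; rewrite ?inE ?ap.
- by case/imsetP => x xM ->; exists (x, x); rewrite ?inE //= eqxx xM orbT.
rewrite inE /= => /orP[ab ->|/andP[/eqP <- aM] ->].
  by left; apply/imsetP; exists (a, b); rewrite ?inE.
by right; apply/imsetP; exists a.
Qed.

Let arc_E2 a b : (arc (a, b) \in E2 M) = (a == b) && (a \in M).
Proof.
apply/imsetP/andP => [[x xM /(@arc_inj (a, b) (x, x))[-> ->]]|[/eqP <- aM]] //.
by exists a.
Qed.

Lemma card_EM : #|Defs.EM adj M| = (\sum_x deg adj x + #|M|)%N.
Proof.
rewrite EM_arcs card_imset; last exact: arc_inj.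
rewrite -sum1_card (eq_bigl (fun p => adj p.1 p.2 || (p.1 == p.2) && (p.1 \in M)));
  last by move=> p; rewrite inE.
rewrite -(pair_big_dep xpredT
  (fun x y => adj x y || (x == y) && (x \in M)) (fun _ _ => 1%N)) /=.
rewrite -[X in (_ + X)%N]sum1_card [X in (_ + X)%N]big_mkcond /= -big_split /=.
apply: eq_bigr => x _.
rewrite (bigID (adj x)) /=; congr (_ + _)%N.
  rewrite /deg -sum1_card; apply: eq_bigl => y; rewrite inE.
  by case: (adj x y); rewrite ?andbF.
rewrite (eq_bigl (fun y => (y == x) && (x \in M))); last first.
  move=> y; have [->|nxy] := eqVneq y x; first by rewrite adj_irr /= andbT.
  by rewrite orbF andbN.
case: (x \in M); last by rewrite big_pred0 // => y; rewrite andbF.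
by rewrite (eq_bigl (pred1 x)) ?big_pred1_eq // => y; rewrite andbT.
Qed.

Let sum_arcs (f : {set (T + T)} -> R) :
  \sum_(i < #|Defs.EM adj M|) f (enum_val i)
  = \sum_x \sum_(y | (x, y) \in arcs) f (arc (x, y)).
Proof.
rewrite -(big_enum_val f) EM_arcs big_imset /=; last by move=> ? ? _ _; exact: arc_inj.
rewrite pair_big_dep; apply: eq_big => [[x y]|[x y]] //.
Qed.

Let Karc a b x : Kentry R adj M (arc (a, b)) x =
  if a == x then
    if x \notin M then (Num.sqrt (deg adj x)%:R)^-1 else (x == b)%:R
  else 0.
Proof.
rewrite /Kentry in_arcl arc_E2 /= eq_sym; case: eqP => [->|_] //=.
by case: (x \in M) => //=; rewrite andbT; case: eqP.
Qed.

Let Larc a b x : Lentry R adj M (arc (a, b)) x =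
  if b == x then
    if x \notin M then (Num.sqrt (deg adj x)%:R)^-1 else (x == a)%:R
  else 0.
Proof.
rewrite /Lentry in_arcr arc_E2 /= eq_sym; case: eqP => [->|_] //=.
case: (boolP (x \in M)) => //= xM; rewrite (eq_sym x).
by case: eqP => [->|] //=; rewrite xM.
Qed.

(** Squared norm of a column: [deg] entries with square [1 / deg] at an unmarked vertex, the single
    edge of [E2] at a marked one. *)
Let sum_out x : \sum_(y | (x, y) \in arcs)
   (if x \notin M then (Num.sqrt (deg adj x)%:R)^-1 else (x == y)%:R) ^+ 2 = 1 :> R.
Proof.
have [xM|xM] /= := boolP (x \in M).
  rewrite (bigD1 x) /=; last by rewrite inE /= eqxx xM orbT.
  rewrite eqxx expr1n big1 ?addr0 // => y /andP[_ /negbTE].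
  by rewrite eq_sym => ->; rewrite expr0n.
rewrite (eq_bigl (fun y => y \in [set y | adj x y])); last first.
  by move=> y; rewrite !inE /= (negbTE xM) andbF orbF.
rewrite sumr_const -/(deg adj x) exprVn sqr_sqrtr ?ler0n // -[LHS]mulr_natr mulVf //.
by rewrite pnatr_eq0 -lt0n.
Qed.

(** Distinct columns have disjoint supports, since an edge has only one end in the first copy. *)
Lemma mulmx_KmxT_Kmx : (Kmx adj M)^T *m Kmx adj M = 1%:M :> 'M[R]_#|T|.
Proof.
apply/matrixP => i j; rewrite !mxE; under eq_bigr do rewrite !mxE.
rewrite (sum_arcs (fun e => Kentry R adj M e (enum_val i)
                            * Kentry R adj M e (enum_val j))).
rewrite (bigD1 (enum_val i)) //= [X in _ + X]big1 ?addr0; last first.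
  by move=> x /negbTE nx; rewrite big1 // => y _; rewrite Karc nx mul0r.
under eq_bigr do rewrite !Karc eqxx.
have [->|nij] := eqVneq i j; first by rewrite eqxx -[RHS](sum_out (enum_val j)).
by rewrite (inj_eq enum_val_inj) (negbTE nij) big1 // => y _; rewrite mulr0.
Qed.

Let swap_arcs x y : ((x, y) \in arcs) = ((y, x) \in arcs).
Proof. by rewrite !inE /= adj_sym eq_sym; case: eqP => // ->. Qed.

(** Exchanging the two copies, which preserves [arcs], reduces this to the computation for [Kmx]. *)
Lemma mulmx_LmxT_Lmx : (Lmx adj M)^T *m Lmx adj M = 1%:M :> 'M[R]_#|T|.
Proof.
apply/matrixP => i j; rewrite !mxE; under eq_bigr do rewrite !mxE.
rewrite (sum_arcs (fun e => Lentry R adj M e (enum_val i)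
                            * Lentry R adj M e (enum_val j))).
rewrite (exchange_big_dep xpredT) //=.
rewrite (bigD1 (enum_val i)) //= [X in _ + X]big1 ?addr0; last first.
  by move=> x /negbTE nx; rewrite big1 // => y _; rewrite Larc nx mul0r.
under eq_bigl do rewrite swap_arcs.
under eq_bigr do rewrite !Larc eqxx.
have [->|nij] := eqVneq i j; first by rewrite eqxx -[RHS](sum_out (enum_val j)).
by rewrite (inj_eq enum_val_inj) (negbTE nij) big1 // => y _; rewrite mulr0.
Qed.

(** The square root of [P x y * P y x], where [P] is the simple random walk made absorbing at the
    marked vertices. *)
Definition discriminant_entry (x y : T) : R :=
  if x \in M then (x == y)%:R
  else if y \in M then 0
  else (adj x y)%:R / (Num.sqrt (deg adj x)%:R * Num.sqrt (deg adj y)%:R).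

Lemma mulmx_KmxT_Lmx : (Kmx adj M)^T *m Lmx adj M =
  \matrix_(i, j) discriminant_entry (enum_val i) (enum_val j) :> 'M[R]_#|T|.
Proof.
apply/matrixP => i j; rewrite !mxE; under eq_bigr do rewrite !mxE.
rewrite (sum_arcs (fun e => Kentry R adj M e (enum_val i)
                            * Lentry R adj M e (enum_val j))).
rewrite (bigD1 (enum_val i)) //= [X in _ + X]big1 ?addr0; last first.
  by move=> x /negbTE nx; rewrite big1 // => y _; rewrite Karc nx mul0r.
move: (enum_val i) (enum_val j) => x y.
rewrite big_mkcond (bigD1 y) //= [X in _ + X]big1 ?addr0; last first.
  by move=> z /negbTE nz; rewrite Larc nz mulr0; case: ifP.
rewrite Karc Larc !eqxx !inE /= /discriminant_entry.
have [xM|xM] /= := boolP (x \in M); have [yM|yM] /= := boolP (y \in M).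
- rewrite andbT (eq_sym y); case: eqP => [->|]; rewrite ?mulr1 ?orbT //.
  by rewrite mul0r; case: ifP.
- rewrite andbT; case: eqP => [xy|]; first by rewrite xy (negbTE yM) in xM.
  by rewrite mul0r; case: ifP.
- have -> : (y == x) = false by apply: contraNF xM => /eqP <-.
  by rewrite mulr0; case: ifP.
- by rewrite andbF orbF invfM; case: ifP; rewrite ?mul1r ?mul0r.
Qed.

End Graph.

(** * Unmarked components of the cycle, indexed by distance *)

(** A finite set of positive integers that is closed downwards is an initial segment, so [k] takes
    exactly the values [1, ..., #|A|] on [A]. *)
Lemma big_down_closed (V : Type) (idx : V) (op : Monoid.com_law idx)
    (T : finType) (A : {set T}) (k : T -> nat) (F : nat -> V) :
    {in A &, injective k} -> {in A, forall x, 0 < k x}%N ->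
    {in A, forall x i, (0 < i < k x)%N -> exists2 y, y \in A & k y = i} ->
  \big[op/idx]_(x in A) F (k x) = \big[op/idx]_(i < #|A|) F i.+1.
Proof.
move=> k_inj k_gt0 k_down.
have uk : uniq (map k (enum A)).
  by rewrite map_inj_in_uniq ?enum_uniq // => x y; rewrite !mem_enum; exact: k_inj.
have k_le x : x \in A -> (k x <= #|A|)%N.
  move=> xA; rewrite -(size_iota 1 (k x)) cardE -(size_map k).
  apply: uniq_leq_size; first exact: iota_uniq.
  move=> i; rewrite mem_iota add1n => /andP[i0].
  rewrite ltnS leq_eqVlt => /predU1P[->|ik].
    by rewrite map_f // mem_enum.
  have [|y yA <-] := k_down x xA i; first by rewrite i0.
  by rewrite map_f // mem_enum.
have sub : {subset map k (enum A) <= iota 1 #|A|}.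
  move=> _ /mapP[x + ->]; rewrite mem_enum => xA.
  by rewrite mem_iota add1n ltnS k_gt0 //= k_le.
have [_ eqi] := uniq_min_size uk sub
  (eq_leq (etrans (size_iota 1 #|A|) (etrans (cardE A) (esym (size_map k (enum A)))))).
rewrite -big_enum -(big_map k xpredT F).
rewrite (perm_big (iota 1 #|A|)); last first.
  by apply: uniq_perm => //; exact: iota_uniq.
by rewrite (iotaDl 1 0) big_map -(big_mkord xpredT (fun i => F i.+1)) /index_iota subn0.
Qed.

Local Arguments cycle_adj N : simpl never.

Section Cycle.
Variables (n : nat) (M : {set 'I_n.+3}).
Notation V := 'I_n.+3.
Notation adj := (cycle_adj n.+3).
Implicit Types x y : V.

Lemma cycle_adjE x y : adj x y = (y == x + 1) || (x == y + 1).
Proof. by rewrite /cycle_adj -!val_eqE /= !addn1. Qed.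

Lemma Zp3_addr1_neq x : (x + 1 == x) = false.
Proof. by rewrite -[X in _ == X]addr0 (inj_eq (addrI x)). Qed.

Lemma Zp3_addr2_neq x : (x + 1 + 1 == x) = false.
Proof. by rewrite -addrA -[X in _ == X]addr0 (inj_eq (addrI x)). Qed.

Lemma cycle_adj_sym : symmetric adj.
Proof. by move=> x y; rewrite !cycle_adjE orbC. Qed.

Lemma cycle_adj_irr : irreflexive adj.
Proof. by move=> x; rewrite cycle_adjE eq_sym Zp3_addr1_neq. Qed.

Lemma deg_cycle x : deg adj x = 2%N.
Proof.
rewrite /deg (_ : [set y | adj x y] = [set x + 1; x - 1]).
  by rewrite cards2 -(inj_eq (addIr 1)) subrK Zp3_addr2_neq.
by apply/setP => y; rewrite !inE cycle_adjE (eq_sym x) -[y == x - 1]subr_eq opprK.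
Qed.

Hypothesis M0 : M != finset.set0.

Let has_marked x : exists j, x - j%:R \in M.
Proof.
have /set0Pn[m mM] := M0; exists (x - m : V).
by rewrite natr_Zp opprB addrC subrK.
Qed.

(** Measured backwards only, so that along a component it counts [1, 2, ...] from the marked vertex
    preceding it. *)
Definition marked_dist x : nat := ex_minn (has_marked x).
Notation k := marked_dist.

Lemma marked_dist_eq0 x : (k x == 0%N) = (x \in M).
Proof.
rewrite /k; case: ex_minnP => j jM j_min.
apply/eqP/idP => [j0|xM]; first by rewrite j0 subr0 in jM.
by apply/eqP; rewrite -leqn0 j_min // subr0.
Qed.

Lemma marked_dist_unmarked x : x \notin M -> k x = (k (x - 1)).+1.
Proof.
move=> xM; apply/eqP; rewrite eqn_leq; apply/andP; split.
  rewrite /k; case: ex_minnP => i iM i_min; case: ex_minnP => j jM j_min.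
  by apply: i_min; rewrite -nat1r opprD addrA.
have := marked_dist_eq0 x; rewrite (negbTE xM) => /negbT; rewrite -lt0n /k.
case: ex_minnP => [[|i]] iM i_min // _; case: ex_minnP => j jM j_min.
by rewrite ltnS; apply: j_min; rewrite -addrA -opprD nat1r.
Qed.

Notation conn := (connect (induced_rel adj M)).

Lemma connect_induced_sym : connect_sym (induced_rel adj M).
Proof.
apply: sym_connect_sym => x y; rewrite /induced_rel /= cycle_adj_sym.
by case: (x \in M); case: (y \in M); rewrite /= ?andbF.
Qed.

Lemma connect_induced_unmarked x y : conn x y -> x \notin M -> y \notin M.
Proof.
move=> /connectP[p + ->]; elim: p x => //= z p IH x /andP[/and3P[_ _ zM] zp] _.
exact: IH zp zM.
Qed.

(** Adjacent unmarked vertices meet the same first marked vertex going backwards. Hence the distance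
    determines a vertex within its component. *)
Lemma connect_induced_anchor x y : conn x y -> x - (k x)%:R = y - (k y)%:R.
Proof.
have step a : a \notin M -> a - (k a)%:R = (a - 1) - (k (a - 1))%:R.
  by move=> aM; rewrite marked_dist_unmarked // -nat1r opprD addrA.
move=> /connectP[p + ->]; elim: p x => //= z p IH x /andP[/and3P[+ xM zM] zp].
rewrite -(IH _ zp) cycle_adjE => /orP[] /eqP E.
  by rewrite (step z) // E addrK.
by rewrite (step x) // E addrK.
Qed.

Lemma comp_of_unmarked x y : x \notin M ->
  ((y \notin M) && ([set z | conn y z] == [set z | conn x z])) = conn x y.
Proof.
move=> xM; apply/andP/idP => [[_ /eqP/setP/(_ y)]|xy].
  by rewrite !inE connect0 => <-.
split; first exact: connect_induced_unmarked xy xM.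
apply/eqP/setP => z; rewrite !inE.
exact/esym/(same_connect connect_induced_sym).
Qed.

(** The common anchor makes [k] injective on a component, and stepping back stays inside it until
    the distance reaches 0; so the distances fill [1, ..., #|C|]. *)
Lemma big_comp (W : Type) (idx : W) (op : Monoid.com_law idx)
    (F : nat -> W) (C : {set V}) : C \in comps adj M ->
  \big[op/idx]_(y in C) F (k y) = \big[op/idx]_(i < #|C|) F i.+1.
Proof.
move=> /imsetP[x + ->]; rewrite inE => xM.
have unm y : conn x y -> y \notin M by move/connect_induced_unmarked; apply.
apply: big_down_closed => [y z|y|y].
- rewrite !inE => xy xz kyz; apply: (addIr (- (k y)%:R)).
  by rewrite -(connect_induced_anchor xy) (connect_induced_anchor xz) kyz.
- by rewrite inE lt0n marked_dist_eq0 => /unm.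
- rewrite inE => xy i; move: {2}(k y) (erefl (k y)) => m.
  elim: m y xy => [|m IH] y xy ky /andP[i0]; rewrite ky; first by rewrite ltn0.
  rewrite ltnS leq_eqVlt.
  have ky' : k (y - 1) = m.
    by move: ky; rewrite marked_dist_unmarked ?(unm _ xy) // => -[].
  have xy' : (0 < m)%N -> conn x (y - 1).
    move=> m0; apply: (connect_trans xy); apply: connect1; rewrite /induced_rel /=.
    rewrite cycle_adjE subrK eqxx orbT (unm _ xy) /=.
    by rewrite -marked_dist_eq0 ky' -lt0n.
  case/predU1P => [im|im].
    by exists (y - 1); rewrite ?inE ?ky' ?xy' // -im.
  apply: (IH (y - 1)) => //; last by rewrite i0 ky'.
  by apply: xy'; exact: leq_ltn_trans im.
Qed.

Lemma big_unmarked_comps (W : Type) (idx : W) (op : Monoid.com_law idx)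
    (F : nat -> W) :
  \big[op/idx]_(y in ~: M) F (k y)
  = \big[op/idx]_(C in comps adj M) \big[op/idx]_(i < #|C|) F i.+1.
Proof.
rewrite (partition_big_imset (fun x => [set y | conn x y])) /=.
apply: eq_bigr => C /[dup] CM /imsetP[x]; rewrite inE => xM CE.
rewrite -(big_comp op F CM); apply: eq_bigl => y.
by rewrite CE !inE comp_of_unmarked.
Qed.

End Cycle.

(** * An LDL^T factorisation along the cycle *)

Section CycleDet.
Variables (R : realFieldType) (n : nat) (M : {set 'I_n.+3}).
Notation V := 'I_n.+3.
Notation adj := (cycle_adj n.+3).
Implicit Types x y : V.
Hypothesis M0 : M != finset.set0.
Notation k := (marked_dist M0).

(* A permutation moving every point by 0 or -1 is the identity or the full
   rotation, and a zero of [c] rules out the latter. *)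
Lemma det_cyclic_unipotent (c : V -> R) : {in M, forall x, c x = 0} ->
  \det (\matrix_(x, y) (if x == y then 1 else if y == x - 1 then c x else 0)) = 1.
Proof.
move=> cM; rewrite /determinant (bigD1 (1%g : 'S_n.+3)) //= [X in _ + X]big1 ?addr0.
  rewrite odd_perm1 mul1r big1 // => x _.
  by rewrite mxE perm1 eqxx.
move=> s; apply: contraNeq; rewrite mulf_eq0 negb_or => /andP[_ /prodf_neq0 nz].
apply/eqP/permP => x; rewrite perm1; apply/eqP/negPn/negP => sx.
have {}nz y : s y != y -> (s y == y - 1) && (y \notin M).
  move=> sy; have := nz y isT; rewrite mxE (eq_sym y) (negbTE sy).
  case: ifP => [_ cy|_]; last by rewrite eqxx.
  by apply: contraNN cy => /cM ->.
(* If [s] sends [y] to [y - 1], injectivity forbids it to fix [y - 1]; movement thus spreads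
   backwards until it hits a marked vertex. *)
have moved j : s (x - j%:R) != x - j%:R.
  elim: j => [|j IH]; first by rewrite subr0.
  have /andP[/eqP sj _] := nz _ IH.
  rewrite -nat1r opprD addrCA addrC -sj (inj_eq perm_inj) sj.
  by rewrite eq_sym -subr_eq opprK Zp3_addr1_neq.
have /set0Pn[m mM] := M0.
have /nz/andP[_] := moved (x - m : V).
by rewrite natr_Zp opprB addrC subrK mM.
Qed.

Variable b : R.
Let p (l : nat) : R := \sum_(i < l.+1) (b ^+ 2) ^+ i.

Let pS l : p l.+1 = 1 + b ^+ 2 * p l.
Proof.
rewrite /p big_ord_recl expr0 mulr_sumr; congr (_ + _).
by apply: eq_bigr => i _; rewrite -exprS.
Qed.

Let p0 : p 0 = 1.
Proof. by rewrite /p big_ord_recl big_ord0 addr0. Qed.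

Let p_gt0 l : 0 < p l.
Proof.
elim: l => [|l IH]; first by rewrite p0.
by rewrite pS ltr_pwDl // mulr_ge0 ?sqr_ge0 // ltW.
Qed.

Let p_neq0 l : p l != 0. Proof. by rewrite gt_eqF. Qed.

(* Pivots and subdiagonal of the LDL^T factorisation. *)
Let d x := if x \in M then (1 - b) ^+ 2 else p (k x) / p (k x).-1.
Let c x := if (x \in M) || (x - 1 \in M) then 0 else - b / d (x - 1).

(** Between unmarked neighbours this is the recurrence [p_(l+2) + b^2 p_l = (1 + b^2) p_(l+1)]; just
    after a marked vertex it is [p_1 = 1 + b^2]. *)
Let d_diag x : d x + c x ^+ 2 * d (x - 1) = if x \in M then (1 - b) ^+ 2 else 1 + b ^+ 2.
Proof.
rewrite /c /d; have [xM|xM] /= := boolP (x \in M); first by rewrite expr0n mul0r addr0.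
rewrite marked_dist_unmarked //=.
have [yM|yM] /= := boolP (x - 1 \in M).
  have /eqP -> : k (x - 1) == 0%N by rewrite marked_dist_eq0.
  by rewrite expr0n mul0r addr0 pS p0 mulr1 divr1.
rewrite (marked_dist_unmarked _ yM) /=; set j := k _.
rewrite [p j.+2]pS pS; have := p_neq0 j; have := p_neq0 j.+1; rewrite pS.
by move: (p j) => q q1 q0; field; rewrite q0.
Qed.

Let c_d x : c x * d (x - 1) = if (x \in M) || (x - 1 \in M) then 0 else - b.
Proof.
rewrite /c; case: ifP; first by rewrite mul0r.
move=> /norP[_ yM]; rewrite divfK // /d (negbTE yM).
by rewrite mulf_neq0 ?invr_neq0.
Qed.

Lemma det_marked_cycle :
  \det (\matrix_(x < n.+3, y < n.+3)
     (if x == y then if x \in M then (1 - b) ^+ 2 else 1 + b ^+ 2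
      else if [&& adj x y, x \notin M & y \notin M] then - b else 0))
  = (1 - b) ^+ (2 * #|M|)
    * \prod_(C in comps adj M) \sum_(i < #|C|.+1) (b ^+ 2) ^+ i.
Proof.
pose L := \matrix_(x < n.+3, y < n.+3)
  (if x == y then 1 else if y == x - 1 then c x else 0).
pose D := diag_mx (\row_(x < n.+3) d x).
have detL : \det L = 1.
  by apply: det_cyclic_unipotent => x xM; rewrite /c xM.
transitivity (\det (L *m D *m L^T)); last first.
  rewrite !det_mulmx det_tr detL mul1r mulr1 det_diag.
  under eq_bigr do rewrite mxE.
  rewrite (bigID (mem M)) /=; congr (_ * _).
    rewrite (eq_bigr (fun=> (1 - b) ^+ 2)); last by move=> x xM; rewrite /d xM.
    by rewrite prodr_const exprM.
  rewrite (eq_bigr (fun x => p (k x) / p (k x).-1)); last first.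
    by move=> x /negbTE xM; rewrite /d xM.
  rewrite (eq_bigl (fun x => x \in ~: M)); last by move=> x; rewrite inE.
  (* The pivots depend on the distance alone, so over a component they telescope to [p #|C|]. *)
  rewrite (big_unmarked_comps M0 _ (fun j => p j / p j.-1)) /=.
  apply: eq_bigr => C _; rewrite -/(p #|C|).
  elim: #|C| => [|l IH]; first by rewrite big_ord0 p0.
  by rewrite big_ord_recr IH /= mulrC divfK.
congr (\det _); apply/matrixP => x y; rewrite !mxE.
have xx1 : (x - 1 == x) = false by rewrite subr_eq eq_sym Zp3_addr1_neq.
rewrite (bigD1 x) //= (bigD1 (x - 1)) ?xx1 //= [X in _ + (_ + X)]big1 ?addr0; last first.
  move=> z /andP[/negbTE zx /negbTE zx1].
  by rewrite mul_mx_diag !mxE eq_sym zx zx1 !mul0r.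
rewrite !mul_mx_diag !mxE !eqxx (eq_sym x (x - 1)) xx1 mul1r.
have [<-|nxy] := eqVneq x y.
  by rewrite eqxx (eq_sym x (x - 1)) xx1 -d_diag; ring.
rewrite (inj_eq (addIr _)) (negbTE nxy) [x == y - 1]eq_sym subr_eq.
rewrite (eq_sym y (x - 1)) subr_eq cycle_adjE c_d.
have [->|_] := eqVneq y (x + 1).
  (* With at least three vertices [x + 1] differs from [x - 1], so only one of the two products
     survives. *)
  rewrite eq_sym Zp3_addr2_neq mulr0 addr0 mulrC.
  have := c_d (x + 1); rewrite addrK => ->.
  by case: (x \in M); case: (x + 1 \in M).
rewrite mulr0 add0r; have [->|_] := eqVneq x (y + 1); last by rewrite mulr0.
by rewrite addrK mulr1; case: (y \in M); case: (y + 1 \in M).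
Qed.

End CycleDet.

(** * The determinant of the search matrix *)

Lemma det_enum_val_ord (R : comNzRingType) (N : nat) (f : 'I_N -> 'I_N -> R) :
  \det (\matrix_(i < #|'I_N|, j < #|'I_N|) f (enum_val i) (enum_val j))
  = \det (\matrix_(x, y) f x y).
Proof.
have castE k (e : k = N) : \det (\matrix_(i, j) f (cast_ord e i) (cast_ord e j))
    = \det (\matrix_(x, y) f x y).
  by case: N / e f => f; congr (\det _); apply/matrixP => i j; rewrite !mxE !cast_ord_id.
rewrite -(castE _ (card_ord N)); congr (\det _).
by apply/matrixP => i j; rewrite !mxE !enum_val_ord.
Qed.

Section DetWsearch.
Variables (R : realType) (n : nat) (M : {set 'I_n.+3}).
Notation V := 'I_n.+3.
Notation adj := (cycle_adj n.+3).
Hypothesis M0 : M != finset.set0.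

(** All degrees are 2, so the nonzero off-diagonal entries of [J] are one half; a marked diagonal
    entry gives [1 + b^2 - 2 b]. *)
Lemma cycle_discriminant_factor (b : R) (x y : V) :
  (1 + b ^+ 2) *+ (x == y) - 2 * b * discriminant_entry R adj M x y =
  (if x == y then if x \in M then (1 - b) ^+ 2 else 1 + b ^+ 2
      else if [&& adj x y, x \notin M & y \notin M] then - b else 0).
Proof.
rewrite /discriminant_entry !deg_cycle -expr2 sqr_sqrtr ?ler0n //.
have [->|nxy] := eqVneq x y.
  by rewrite cycle_adj_irr mul0r if_same !mulr1n; case: ifP => _; ring.
rewrite !mulr0n; case: (x \in M); first by rewrite andbF mulr0 subr0.
case: (y \in M); first by rewrite /= andbF mulr0 subr0.
by rewrite !andbT; case: (adj x y); rewrite ?(mulr1n, mulr0n); field.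
Qed.

(** Turns [J J^T] into a square, so that [(1 + u)^2 - 4 u J J^T] splits as a difference of
    squares. *)
Lemma discriminant_entry_sym (x y : V) :
  discriminant_entry R adj M x y = discriminant_entry R adj M y x.
Proof.
rewrite /discriminant_entry cycle_adj_sym [_ * Num.sqrt _]mulrC eq_sym.
by case: eqP => [->|] //; case: (x \in M); case: (y \in M).
Qed.

Lemma det_1B_Wsearch_cycle (u : R) : 0 < u < 1 ->
  \det (1%:M - u *: Wsearch adj M) =
  (1 - u) ^+ (3 * #|M|) * \prod_(C in comps adj M) (\sum_(i < #|C|.+1) u ^+ i) ^+ 2.
Proof.
move=> /andP[u0 u1].
have deg0 x : (0 < deg adj x)%N by rewrite deg_cycle.
have u1' : 1 - u != 0 by rewrite gt_eqF // subr_gt0.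
have u1'' : 1 + u != 0 by rewrite gt_eqF // addr_gt0.
have := det_1B_two_reflections (mulmx_KmxT_Kmx R M deg0)
  (mulmx_LmxT_Lmx R M (@cycle_adj_sym n) deg0) u1' u1''.
rewrite -/(Wsearch adj M) mulmx_KmxT_Lmx.
set J := \matrix_(_, _) _; set D := \det (1%:M - u *: Wsearch adj M).
have -> : #|Defs.EM adj M| = (2 * #|V| + #|M|)%N.
  rewrite card_EM; last exact: cycle_adj_irr.
  by congr (_ + _)%N; under eq_bigr do rewrite deg_cycle; rewrite sum_nat_const mulnC.
have JT : J^T = J by apply/matrixP => i j; rewrite !mxE discriminant_entry_sym.
pose b := Num.sqrt u.
have bu : b ^+ 2 = u by rewrite sqr_sqrtr // ltW.
have fact (c : R) : c ^+ 2 = u -> \det ((1 + u)%:M - (2 * c) *: J) =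
   (1 - c) ^+ (2 * #|M|) * \prod_(C in comps adj M) \sum_(i < #|C|.+1) u ^+ i.
  move=> cu; rewrite -cu -(det_marked_cycle M0) -det_enum_val_ord; congr (\det _).
  by apply/matrixP => i j; rewrite !mxE -cycle_discriminant_factor (inj_eq enum_val_inj).
have -> : ((1 + u) ^+ 2)%:M - (4 * u) *: (J *m J^T)
   = ((1 + u)%:M - (2 * b) *: J) *m ((1 + u)%:M - (2 * - b) *: J).
  rewrite JT mulmxBl !mulmxBr -!scalemxAl -!scalemxAr -scalar_mxM.
  rewrite mul_scalar_mx mul_mx_scalar scalerA !scalerA -expr2.
  move: (J *m J) => P; rewrite -bu.
  by apply/matrixP => i j; rewrite !mxE; case: (i == j); rewrite ?(mulr1n, mulr0n); ring.
rewrite det_mulmx !fact ?sqrrN // opprK exprD.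
set Q := \prod_(C in _) _ => E.
have z0 : (1 - u) ^+ (2 * #|V|) != 0 by rewrite expf_neq0.
apply: (mulIf z0); rewrite {}E prodrXl -/Q !exprM.
(* The factors for [b] and [- b] give [(1 - b)^2 (1 + b)^2 = (1 - u)^2] per marked vertex, and its
   edge in [E2] gives one more [1 - u]. *)
have -> : (1 - u) ^+ 3 = (1 - u) * ((1 - b) ^+ 2 * (1 + b) ^+ 2) by rewrite -bu; ring.
by rewrite !exprMn expr2; ring.
Qed.

End DetWsearch.

(** * Cosine products from roots of unity *)

Section RootsOfUnity.
Variable R : realType.

Lemma expr_cos_isin (t : R) (k : nat) :
  (Complex (cos t) (sin t)) ^+ k = Complex (cos (k%:R * t)) (sin (k%:R * t)).
Proof.
elim: k => [|k IH]; first by rewrite mul0r cos0 sin0.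
rewrite exprS IH -addn1 natrD mulrDl mul1r cosD sinD.
by apply/eqP; rewrite eq_complex /=; apply/andP; split; apply/eqP; ring.
Qed.

Lemma prim_root_cos_isin (n : nat) : (0 < n)%N ->
  n.-primitive_root (Complex (cos (2 * pi / n%:R : R)) (sin (2 * pi / n%:R))).
Proof.
move=> n0; rewrite /primitive_root_of_unity n0; apply/forallP => i.
have n0' : (0 : R) < n%:R by rewrite ltr0n.
apply/eqP; rewrite unity_rootE expr_cos_isin.
apply/idP/idP; last first.
  move=> /eqP ->; have -> : n%:R * (2 * pi / n%:R) = pi *+ 2 :> R.
    by field; rewrite gt_eqF.
  by rewrite cos2pi sin2pi.
rewrite eq_complex /= => /andP[/eqP c1 _].
rewrite eqn_leq ltn_ord /= leqNgt; apply/negP => lt_in.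
(* The half angle lies strictly between 0 and pi, while [cos (2 t) = 1] would force [sin t = 0]. *)
pose t : R := i.+1%:R * pi / n%:R.
have tE : i.+1%:R * (2 * pi / n%:R) = t *+ 2 by rewrite /t mulr2n; field; rewrite gt_eqF.
have : 0 < sin t.
  apply: sin_gt0_pi; rewrite divr_gt0 ?mulr_gt0 ?pi_gt0 ?ltr0n //=.
  by rewrite ltr_pdivrMr // mulrC ltr_pM2l ?pi_gt0 // ltr_nat.
move: c1; rewrite tE cos_mulr2n cos2sin2 => c1 s0.
have : sin t ^+ 2 = 0 by lra.
by move/eqP; rewrite sqrf_eq0 gt_eqF.
Qed.

(** Each factor is the squared modulus of [u - z^k] for a primitive root [z], so the product is that
    of [u^n - 1]. *)
Lemma prod_1B2cosD (n : nat) (u : R) : (0 < n)%N ->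
  \prod_(k < n) (1 - 2 * cos (2 * k%:R * pi / n%:R) * u + u ^+ 2)
  = (1 - u ^+ n) ^+ 2.
Proof.
move=> n0; apply: (@complexI R).
have := factor_Xn_sub_1 (prim_root_cos_isin n0).
set z := Complex _ _ => /(congr1 (fun p => p.[u%:C]%C)).
rewrite horner_prod hornerD hornerN hornerXn hornerC big_mkord => E.
have -> : ((1 - u ^+ n) ^+ 2)%:C%C = (u%:C%C ^+ n - 1) * (u%:C%C ^+ n - 1)^*%C.
  rewrite -[1 in RHS](rmorph1 (@real_complex R)) -rmorphXn -rmorphB /=.
  apply/eqP; rewrite eq_complex /=.
  by apply/andP; split; apply/eqP; ring.
rewrite -E [(\prod_(i < n) _)^*%C](rmorph_prod (@conjc R)).
rewrite (rmorph_prod (@real_complex R)) -big_split /=.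
apply: eq_bigr => k _; rewrite !hornerE /z expr_cos_isin.
have -> : k%:R * (2 * pi / n%:R) = 2 * k%:R * pi / n%:R :> R.
  by field; rewrite pnatr_eq0 -lt0n.
set t := _ / _.
have := cos2Dsin2 t.
move: (cos t) (sin t) => c s cs.
apply/eqP; rewrite eq_complex /=; apply/andP; split; apply/eqP; last by ring.
by transitivity (u ^+ 2 - 2 * c * u + (c ^+ 2 + s ^+ 2)); [rewrite cs; ring | ring].
Qed.

(** The factor of index 0 in [prod_1B2cosD] is [(1 - u)^2]; cancelling it leaves a squared geometric
    sum. *)
Lemma prod_1B2cosD_geom (l : nat) (u : R) : 1 - u != 0 ->
  \prod_(k < l) (1 - 2 * cos (2 * k.+1%:R * pi / l.+1%:R) * u + u ^+ 2)
  = (\sum_(i < l.+1) u ^+ i) ^+ 2.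
Proof.
move=> u1; have := @prod_1B2cosD l.+1 u isT.
rewrite big_ord_recl /= mulr0 !mul0r cos0 => E.
have u2 : (1 - u) ^+ 2 != 0 by rewrite sqrf_eq0.
apply: (mulfI u2); rewrite -exprMn -[(1 - u) * _]opprK -mulNr opprB.
rewrite -subrX1 opprB -E; congr (_ * _); ring.
Qed.

End RootsOfUnity.

(** * Riemann sums of functions with bounded derivative *)

Local Open Scope classical_set_scope.
Local Open Scope ring_scope.

Section Riemann.
Variables (R : realType) (f df : R -> R) (C : R).
Hypothesis (fd : forall x : R, is_derive x 1 f (df x)).
Hypothesis dfC : forall x, `|df x| <= C.

Lemma is_derive_all_continuous : continuous f.
Proof.
move=> x; apply/differentiable_continuous/derivable1_diffP.
by case: (fd x).
Qed.

Lemma lipschitz_of_derive (x y : R) : x <= y -> `|f y - f x| <= C * (y - x).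
Proof.
move=> xy.
have [c _ ->] := MVT_segment xy (fun z _ => fd z)
   (continuous_subspaceT is_derive_all_continuous).
by rewrite normrM [X in _ * X]ger0_norm ?subr_ge0 // ler_wpM2r ?subr_ge0.
Qed.

(** Starting at -1 rather than 0 makes 0 an interior point, so that [F] has a two-sided derivative
    there. *)
Let F x := \int[lebesgue_measure]_(t in `[-1, x]) f t.

Let integrable_f (a b : R) : lebesgue_measure.-integrable `[a, b] (EFin \o f).
Proof.
apply: continuous_compact_integrable; first exact: segment_compact.
exact: continuous_subspaceT is_derive_all_continuous.
Qed.

Let Fd (x : R) : 0 <= x -> is_derive x 1 F (f x).
Proof.
move=> x0.
have xx : x < x + 1 by rewrite ltrDl.
have x1 : -1 < x by rewrite (lt_le_trans _ x0) // ltrN10.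
have cfx : {for x, continuous f} := @is_derive_all_continuous x.
have [d <-] := continuous_FTC1_closed xx (integrable_f (-1) (x + 1)) x1 cfx.
by rewrite derive1E; apply: DeriveDef.
Qed.

(** The mean value theorem gives [F (x + h) - F x = h f(c)], and [f c] is within [C h] of [f x]. *)
Let F_step (x h : R) : 0 <= x -> 0 <= h -> `|F (x + h) - F x - h * f x| <= C * h ^+ 2.
Proof.
move=> x0 h0.
have xh : x <= x + h by rewrite lerDl.
have Fc : {within `[x, x + h], continuous F}.
  apply: derivable_within_continuous => z; rewrite in_itv /= => /andP[xz _].
  by case: (Fd (le_trans x0 xz)).
have Fd' z : z \in `]x, x + h[ -> is_derive z 1 F (f z).
  by rewrite in_itv /= => /andP[xz _]; apply: Fd; rewrite (le_trans x0) // ltW.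
have [c + ->] := MVT_segment xh Fd' Fc.
rewrite in_itv /= => /andP[xc cxh].
have -> : f c * (x + h - x) - h * f x = (f c - f x) * h by ring.
rewrite normrM (ger0_norm h0) expr2 mulrA ler_wpM2r //.
apply: (le_trans (lipschitz_of_derive xc)).
rewrite ler_wpM2l ?lerBlDl //.
exact: le_trans (dfC 0).
Qed.

(** The integral telescopes over [n] steps, each with error at most [C (b / n)^2]. *)
Lemma Riemann_sum_error (b : R) (n : nat) : 0 <= b -> (0 < n)%N ->
  `|\int[lebesgue_measure]_(t in `[0, b]) f t
    - b / n%:R * \sum_(k < n) f (k%:R * (b / n%:R))| <= C * b ^+ 2 / n%:R.
Proof.
move=> b0 n0; set h := b / n%:R.
have n0' : (0 : R) < n%:R by rewrite ltr0n.
have h0 : 0 <= h by rewrite divr_ge0 // ltW.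
have -> : \int[lebesgue_measure]_(t in `[0, b]) f t = F b - F 0.
  rewrite (@Rintegral_itvB _ f (BLeft (-1)) (BRight b) 0) //.
  - rewrite Rintegral_itv_obnd_cbnd //.
    apply: integrableS (integrable_f (-1) b) => //.
    by apply: subset_itvr; rewrite bnd_simp lerN10.
  - by rewrite bnd_simp lerN10.
have -> : F b - F 0 = \sum_(k < n) (F (k.+1%:R * h) - F (k%:R * h)).
  rewrite -(big_mkord xpredT (fun k => F (k.+1%:R * h) - F (k%:R * h))).
  rewrite telescope_sumr // mul0r /h; congr (F _ - _).
  by field; rewrite gt_eqF.
rewrite mulr_sumr -sumrB; apply: (le_trans (ler_norm_sum _ _ _)).
apply: (@le_trans _ _ (\sum_(k < n) C * h ^+ 2)).
  apply: ler_sum => k _.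
  rewrite -(natr1 k) mulrDl mul1r; apply: F_step => //.
  by rewrite mulr_ge0.
rewrite sumr_const card_ord -mulr_natr /h.
by rewrite le_eqVlt; apply/orP; left; apply/eqP; field; rewrite gt_eqF.
Qed.

End Riemann.

(** * The vanishing logarithmic integral *)

Lemma ln_prod (R : realType) (I : Type) (r : seq I) (P : pred I) (F : I -> R) :
  (forall i, P i -> 0 < F i) ->
  ln (\prod_(i <- r | P i) F i) = \sum_(i <- r | P i) ln (F i).
Proof.
move=> F0.
suff [] : 0 < \prod_(i <- r | P i) F i /\
          ln (\prod_(i <- r | P i) F i) = \sum_(i <- r | P i) ln (F i) by [].
elim/big_rec2: _ => [|i x y Pi [y0 <-]]; first by rewrite ln1.
by rewrite mulr_gt0 ?F0 // lnM ?posrE ?F0.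
Qed.

Section LogIntegral.
Variables (R : realType) (u : R).
Hypothesis u01 : 0 < u < 1.

Let q (t : R) : R := 1 - 2 * cos t * u + u ^+ 2.

(** The quadratic is the squared distance from 1 to [u e^(i t)]. *)
Lemma quad_cos_ge (t : R) : (1 - u) ^+ 2 <= 1 - 2 * cos t * u + u ^+ 2.
Proof.
have /andP[u0 _] := u01.
have : 0 <= (1 - cos t) * u by rewrite mulr_ge0 ?(ltW u0) // subr_ge0 cos_le1.
by nra.
Qed.

Lemma quad_cos_gt0 (t : R) : 0 < 1 - 2 * cos t * u + u ^+ 2.
Proof.
apply: lt_le_trans (quad_cos_ge t).
by have /andP[_ u1] := u01; rewrite exprn_gt0 // subr_gt0.
Qed.

Lemma is_derive_ln_quad_cos (t : R) :
  is_derive t 1 (fun t => ln (1 - 2 * cos t * u + u ^+ 2))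
    ((1 - 2 * cos t * u + u ^+ 2)^-1 * (2 * u * sin t)).
Proof.
apply: (@is_derive1_comp _ (@ln R) q).
  exact/is_derive1_ln/quad_cos_gt0.
have -> : q = (fun t => (1 + u ^+ 2) + (- (2 * u)) * cos t).
  by apply/funext => x; rewrite /q; ring.
apply: is_derive_eq.
by rewrite add0r mul1r /GRing.scale /=; ring.
Qed.

Lemma ln_quad_cos_derive_le (t : R) :
  `|(1 - 2 * cos t * u + u ^+ 2)^-1 * (2 * u * sin t)| <= (1 - u) ^- 2 * (2 * u).
Proof.
have /andP[u0 u1] := u01.
rewrite !normrM normfV (gtr0_norm (quad_cos_gt0 t)) (ger0_norm (ltW u0)) ger0_norm //.
rewrite ler_pM ?invr_ge0 ?mulr_ge0 ?(ltW (quad_cos_gt0 t)) ?(ltW u0) //.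
  rewrite lef_pV2 ?posrE ?quad_cos_gt0 ?exprn_gt0 ?subr_gt0 //; exact: quad_cos_ge.
rewrite ler_piMr ?mulr_ge0 ?(ltW u0) // ler_norml.
by rewrite sin_le1 sin_geN1.
Qed.

Lemma sum_ln_quad_cos (n : nat) : (0 < n)%N ->
  \sum_(k < n) ln (1 - 2 * cos (2 * k%:R * pi / n%:R) * u + u ^+ 2)
  = 2 * ln (1 - u ^+ n).
Proof.
move=> n0; have /andP[u0 u1] := u01.
rewrite -ln_prod => [|k _]; last exact: quad_cos_gt0.
by rewrite prod_1B2cosD // lnXn ?mulr_natl // subr_gt0 exprn_ilt1 // ?(ltW u0) // -lt0n.
Qed.

(** The left Riemann sums are explicit, [(4 pi / n) ln (1 - u^n)], so both they and the quadrature
    error are O(1/n). *)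
Lemma integral_ln_quad_cos :
  \int[lebesgue_measure]_(t in `[0, 2 * pi]) ln (1 - 2 * cos t * u + u ^+ 2) = 0.
Proof.
have /andP[u0 u1] := u01.
set I := (X in X = 0).
(* The first term is the quadrature error from [ln_quad_cos_derive_le]; the second bounds the
   Riemann sum by means of [u^n <= u]. *)
pose A : R := (1 - u) ^- 2 * (2 * u) * (2 * pi) ^+ 2 + 2 * pi * (2 * - ln (1 - u)).
have pi0 : 0 <= 2 * pi :> R by rewrite mulr_ge0 ?pi_ge0.
have IA (n : nat) : (0 < n)%N -> `|I| <= A / n%:R.
  move=> n0.
  have nR : (0 : R) < n%:R by rewrite ltr0n.
  have := Riemann_sum_error is_derive_ln_quad_cos ln_quad_cos_derive_le pi0 n0.
  rewrite -/I; under eq_bigr => k _.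
    rewrite (_ : k%:R * (2 * pi / n%:R) = 2 * k%:R * pi / n%:R); last by ring.
    over.
  rewrite sum_ln_quad_cos // => H.
  have un : u ^+ n <= u.
    by case: n n0 {nR H} => // n _; rewrite exprS ler_piMr ?exprn_ile1 // ltW.
  rewrite -[I](subrK (2 * pi / n%:R * (2 * ln (1 - u ^+ n)))).
  apply: (le_trans (ler_normD _ _)); rewrite /A [leRHS]mulrDl lerD //.
  have h0 : 0 <= 2 * pi / n%:R :> R by rewrite divr_ge0 // ltW.
  rewrite [leRHS]mulrAC normrM (ger0_norm h0); apply: ler_wpM2l => //.
  have ln0 : ln (1 - u ^+ n) <= 0 by rewrite ln_le0 // gerBl exprn_ge0 // ltW.
  rewrite normrM (ger0_norm (ler0n _ 2)); apply: ler_wpM2l => //.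
  rewrite (ler0_norm ln0) lerN2 ler_ln ?posrE ?subr_gt0 //; last exact: le_lt_trans u1.
  by rewrite lerB.
apply/eqP; rewrite -normr_eq0; apply/eqP/le_anti; rewrite normr_ge0 andbT leNgt.
apply/negP => I0.
have A0 : 0 <= A / `|I|.
  rewrite divr_ge0 //; apply: le_trans (normr_ge0 I) _.
  by have := IA 1%N isT; rewrite divr1.
have nb := archi_boundP A0.
set n := Num.bound _ in nb.
have n0 : (0 < n)%N by rewrite -(ltr0n R) (le_lt_trans A0).
have := IA n n0; rewrite ler_pdivlMr ?ltr0n // leNgt => /negP; apply.
by move: nb; rewrite ltr_pdivrMr // mulrC.
Qed.

End LogIntegral.

(** * Isolated vertices and bounds on geometric sums *)

Section Isolated.
Variables (T : finType) (adj : rel T) (M : {set T}).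

Lemma Fprime_comp x : x \in Fprime adj M -> [set x]%SET \in comps adj M.
Proof.
rewrite inE => /andP[xM /forallP xF].
apply/imsetP; exists x; rewrite ?inE //; apply/setP => y; rewrite !inE.
apply/eqP/idP => [->|/connectP[[|z p] /=]]; [exact: connect0 | by [] |].
by case/andP => /and3P[/(implyP (xF z)) -> _].
Qed.

(** The components left out of [Fcomps] are exactly the singletons of points of [Fprime]. *)
Lemma sum_comps (V : nmodType) (g : nat -> V) :
  \sum_(C in comps adj M) g #|C|
  = g 1%N *+ #|Fprime adj M| + \sum_(C in Fcomps adj M) g #|C|.
Proof.
rewrite (bigID (fun C => C \in Fcomps adj M)) /= addrC; congr (_ + _); last first.
  by apply: eq_bigl => C; rewrite andb_idl // inE => /andP[].
rewrite (eq_bigl (fun C => C \in [set [set x] | x in Fprime adj M]%SET)); last first.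
  move=> C; rewrite inE negb_and; apply/andP/imsetP => [[CM]|[x xF ->]].
    rewrite CM /= negb_forall => /existsP[x]; rewrite negb_imply negbK.
    by move=> /andP[xF /eqP ->]; exists x.
  rewrite Fprime_comp //; split=> //=.
  by apply/forallPn; exists x; rewrite negb_imply xF eqxx.
rewrite big_imset /=; last by move=> x y _ _; exact: set1_inj.
by under eq_bigr do rewrite cards1; rewrite sumr_const.
Qed.

End Isolated.

Section Geometric.
Variables (R : realType) (u : R).
Hypothesis u01 : 0 < u < 1.

Lemma geom_ge1 (l : nat) : 1 <= \sum_(i < l.+1) u ^+ i.
Proof.
have /andP[u0 _] := u01.
rewrite big_ord_recl expr0 lerDl sumr_ge0 // => i _.
by rewrite exprn_ge0 // ltW.
Qed.

Lemma sum_ln_quad_cosS (l : nat) :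
  \sum_(k < l) ln (1 - 2 * cos (2 * k.+1%:R * pi / l.+1%:R) * u + u ^+ 2)
  = ln ((\sum_(i < l.+1) u ^+ i) ^+ 2).
Proof.
have /andP[_ u1] := u01.
rewrite -ln_prod => [|k _]; last exact: quad_cos_gt0.
by rewrite prod_1B2cosD_geom // gt_eqF // subr_gt0.
Qed.

(** The geometric sum lies between 1 and [1 / (1 - u)]. The bound is uniform in [l], so a component
    of any length adds only O(1/N) to the exponent. *)
Lemma norm_ln_geom2_le (l : nat) :
  `|ln ((\sum_(i < l.+1) u ^+ i) ^+ 2)| <= - ln (1 - u) *+ 2.
Proof.
have /andP[u0 u1] := u01.
have p1 := geom_ge1 l; have p0 := lt_le_trans ltr01 p1.
rewrite lnXn // ger0_norm ?mulrn_wge0 ?ln_ge0 // lerMn2r /=.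
rewrite lerNr -lnV ?posrE // ler_ln ?posrE ?subr_gt0 ?invr_gt0 //.
rewrite -[leRHS]mul1r ler_pdivlMr //.
rewrite -[leLHS]opprK -mulNr opprB -subrX1 opprB gerBl.
by rewrite exprn_ge0 // ltW.
Qed.

End Geometric.

(** * The zeta function and its limit *)

Lemma zeta_cycleV (R : realType) (N : nat) (M : {set 'I_N}) (u : R) :
  (3 <= N)%N -> M != finset.set0 -> 0 < u < 1 ->
  (zeta (cycle_adj N) M u)^-1 =
    expR (3 * (#|M|%:R / N%:R) * ln (1 - u)
          + 2 * (#|Fprime (cycle_adj N) M|%:R / N%:R) * ln (1 + u)
          + (N%:R)^-1 * \sum_(C in Fcomps (cycle_adj N) M)
                           ln ((\sum_(i < #|C|.+1) u ^+ i) ^+ 2)).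
Proof.
case: N M => [|[|[|n]]] // M _ M0 u01; have /andP[u0 u1] := u01.
have u1' : 0 < 1 - u by rewrite subr_gt0.
have p2 (l : nat) : 0 < (\sum_(i < l.+1) u ^+ i) ^+ 2.
  by rewrite exprn_gt0 // (lt_le_trans ltr01) // geom_ge1.
have Q0 : 0 < \prod_(C in comps (cycle_adj n.+3) M) (\sum_(i < #|C|.+1) u ^+ i) ^+ 2.
  exact: prodr_gt0.
(* [powR] takes a special value at base 0; positivity of the determinant gives its exponential
   form. *)
rewrite /zeta det_1B_Wsearch_cycle // /powR gt_eqF ?mulr_gt0 ?exprn_gt0 //.
rewrite -expRN lnM ?posrE ?exprn_gt0 // lnXn // ln_prod //.
rewrite (sum_comps _ _ (fun l => ln ((\sum_(i < l.+1) u ^+ i) ^+ 2))).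
(* An isolated vertex contributes [ln ((1 + u)^2)], whence the coefficient 2 of [ln (1 + u)]. *)
rewrite lnXn; last by rewrite (lt_le_trans ltr01) // geom_ge1.
rewrite !big_ord_recl big_ord0 /= expr0 expr1 addr0 card_ord.
set S := (X in _ + (_ + X)); congr expR.
have -> : \sum_(C in Fcomps (cycle_adj n.+3) M)
    ln ((\sum_(i < #|C|.+1) u ^+ i) ^+ 2) = S by [].
rewrite -[ln (1 - u) *+ _]mulr_natr -mulrnA -[ln (1 + u) *+ _]mulr_natr !natrM.
have : n.+3%:R != 0 :> R by rewrite pnatr_eq0.
move: n.+3%:R S (#|M|%:R) (#|Fprime _ _|%:R) (ln _) (ln _) => N S a f c d N0.
by field.
Qed.

Theorem theorem1 (R : realType) :
  (forall (N : nat) (M : {set 'I_N}) (u : R),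
     (3 <= N)%N -> M != finset.set0 -> 0 < u < 1 ->
     (zeta (cycle_adj N) M u)^-1 =
       expR (3 * (#|M|%:R / N%:R) * ln (1 - u)
             + 2 * (#|Fprime (cycle_adj N) M|%:R / N%:R) * ln (1 + u)
             + (N%:R)^-1 * \sum_(C in Fcomps (cycle_adj N) M)
                  \sum_(k < #|C|)
                     ln (1 - 2 * cos (2 * (k.+1)%:R * pi / (#|C|.+1)%:R) * u
                         + u ^+ 2)))
  /\
  (forall (u cM cF' : R) (cs : seq R) (Ns : nat -> nat)
          (Ms : forall n, {set 'I_(Ns n)}),
     0 < u < 1 ->
     (forall B : nat, exists n0 : nat, forall n, (n0 <= n)%N -> (B <= Ns n)%N) ->
     (forall n, 3 <= Ns n)%N ->
     (forall n, Ms n != finset.set0) ->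
     (forall n, #|Ms n|%:R = cM * (Ns n)%:R) ->
     (forall n, #|Fprime (cycle_adj (Ns n)) (Ms n)|%:R = cF' * (Ns n)%:R) ->
     (forall n, perm_eq [seq (#|C|%:R : R) | C : {set 'I_(Ns n)} <- enum (Fcomps (cycle_adj (Ns n)) (Ms n))]
                        [seq c * (Ns n)%:R | c <- cs]) ->
     (fun n => (zeta (cycle_adj (Ns n)) (Ms n) u)^-1) @ \oo -->
       expR (3 * cM * ln (1 - u) + 2 * cF' * ln (1 + u)
             + (\sum_(c <- cs) c) *
               ((\int[lebesgue_measure]_(t in `[0, 2 * pi]%classic)
                   ln (1 - 2 * cos t * u + u ^+ 2)) / (2 * pi)))).
Proof.
split=> [N M u N3 M0 u01|u cM cF' cs Ns Ms u01 Noo N3 M0 cME cFE csE].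
  rewrite zeta_cycleV //; congr (expR (_ + _ * _)).
  by apply: eq_bigr => C _; rewrite sum_ln_quad_cosS.
(* The integral term is 0, so it remains to show that the averaged sum [w] over components tends to
   0. *)
rewrite integral_ln_quad_cos // mul0r mulr0.
pose w n := (Ns n)%:R^-1 * \sum_(C in Fcomps (cycle_adj (Ns n)) (Ms n))
                           ln ((\sum_(i < #|C|.+1) u ^+ i) ^+ 2).
have N0 n : (0 : R) < (Ns n)%:R by rewrite ltr0n (leq_trans _ (N3 n)).
have -> : (fun n => (zeta (cycle_adj (Ns n)) (Ms n) u)^-1) =
          (fun n => expR (3 * cM * ln (1 - u) + 2 * cF' * ln (1 + u) + w n)).
  apply/funext => n; rewrite zeta_cycleV // cME cFE.
  by rewrite !mulfK // gt_eqF.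
suff w0 : w @ \oo --> (0 : R).
  set A := 3 * cM * ln (1 - u) + 2 * cF' * ln (1 + u).
  have Aw : (fun n => A + w n) @ \oo --> (A + 0 : R).
    by apply: cvgD w0; exact: cvg_cst.
  exact: (cvg_comp _ _ Aw (@continuous_expR R (A + 0))).
(* There are [size cs] components for every [n], each bounded by [norm_ln_geom2_le]. *)
pose K : R := (- ln (1 - u) *+ 2) *+ size cs.
have wK n : `|w n| <= K / (Ns n)%:R.
  rewrite /w normrM mulrC normfV (gtr0_norm (N0 n)) ler_pM2r ?invr_gt0 //.
  apply: (le_trans (ler_norm_sum _ _ _)).
  apply: (@le_trans _ _ (\sum_(C in Fcomps (cycle_adj (Ns n)) (Ms n))
                            (- ln (1 - u) *+ 2))).
    by apply: ler_sum => C _; exact: norm_ln_geom2_le.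
  by rewrite sumr_const cardE -(size_map (fun C : {set 'I_(Ns n)} => #|C|%:R : R))
    (perm_size (csE n)) size_map.
have K0 : 0 <= K.
  have := wK 0%N; rewrite ler_pdivlMr // => /(le_trans _); apply.
  by rewrite mulr_ge0 // ltW.
apply/cvgrPdist_le => e e0.
(* Once [Ns n] exceeds [K / e], the bound [K / Ns n] is below [e]. *)
have [n0 n0P] := Noo (Num.bound (K / e)).
exists n0 => // n /= /n0P nN; rewrite sub0r normrN.
apply: (le_trans (wK n)); rewrite ler_pdivrMr // mulrC -ler_pdivrMr //.
apply: ltW; apply: lt_le_trans (archi_boundP _) _; first by rewrite divr_ge0 // ltW.
by rewrite ler_nat.
Qed.
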